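(* Let $\psi:(0,\infty)\to(0,\infty)$ and let $\delta_{\psi}(\mathbf{X})=\psi(D)X_2$ be a scale equivariant estimator of $\theta_2$. Let $l^{(2)}(t)$ and $u^{(2)}(t)$ be functions such that $0<l^{(2)}(t)\le m^{(2)}_{\lambda}(t)\le u^{(2)}(t)$ for all $\lambda\ge 1$ and any $t$. Define, for each $t$, $\psi^{*}(t)=\max\left\{\frac{1}{u^{(2)}(t)},\min\left\{\psi(t),\frac{1}{l^{(2)}(t)}\right\}\right\}$. If $P_{\boldsymbol\theta}\left[\frac{1}{u^{(2)}(D)}\le\psi(D)\le\frac{1}{l^{(2)}(D)}\right]<1$ for all $\boldsymbol\theta\in\Theta_0$, then, under the GPN criterion with a general loss function, the estimator $\delta_{\psi^{*}}(\mathbf{X})=\psi^{*}(D)X_2$ is nearer to $\theta_2$ than $\delta_{\psi}(\mathbf{X})=\psi(D)X_2$.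
   Context: $f$ is a specified Lebesgue probability density, and $\mathbf{X}=(X_1,X_2)$ has joint p.d.f. $\frac{1}{\theta_1\theta_2}f\left(\frac{x_1}{\theta_1},\frac{x_2}{\theta_2}\right)$, where $\boldsymbol\theta=(\theta_1,\theta_2)\in\Theta_0=\{(t_1,t_2)\in(0,\infty)^2:t_1\le t_2\}$ is unknown; the support of $\mathbf{X}$ is assumed to be a subset of $(0,\infty)^2$. Put $\lambda=\theta_2/\theta_1\ge1$, $D=X_2/X_1$, $Z_2=X_2/\theta_2$. The p.d.f. of $D$ is $f_D(t|\lambda)=\int_0^\infty\frac{\lambda y}{t^2}f\left(\frac{\lambda y}{t},y\right)dy$, and the conditional p.d.f. of $Z_2$ given $D=t$ is $f_\lambda(s|t)=\frac{\lambda s}{t^2}f\left(\frac{\lambda s}{t},s\right)/f_D(t|\lambda)$ ($t$ in the support of $D$). $m^{(2)}_\lambda(t)$ denotes the median of this conditional distribution, so $\int_0^{m^{(2)}_\lambda(t)}sf(\frac{\lambda s}{t},s)\,ds=\frac12\int_0^\infty sf(\frac{\lambda s}{t},s)\,ds$. General loss function: $L_2(\boldsymbol\theta,a)=W(a/\theta_2)$, $a\in(0,\infty)$, where $W:(0,\infty)\to[0,\infty)$ satisfies $W(1)=0$, $W$ strictly decreasing on $(0,1)$ and strictly increasing on $(1,\infty)$. GPN criterion: for estimators $\delta_1,\delta_2$ of $\theta_2$, $GPN(\delta_1,\delta_2;\boldsymbol\theta)=P_{\boldsymbol\theta}[L_2(\boldsymbol\theta,\delta_1)<L_2(\boldsymbol\theta,\delta_2)]+\frac12P_{\boldsymbol\theta}[L_2(\boldsymbol\theta,\delta_1)=L_2(\boldsymbol\theta,\delta_2)]$.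 $\delta_1$ is nearer to $\theta_2$ than $\delta_2$ if $GPN(\delta_1,\delta_2;\boldsymbol\theta)\ge\frac12$ for all $\boldsymbol\theta\in\Theta_0$, with strict inequality for some $\boldsymbol\theta\in\Theta_0$. All functions defining estimators are understood to be Borel measurable.
   Formalization: The loss W is additionally assumed continuous at 1: without it the strict inequality can fail (W=1/x below 1, W=1-1/x above 1, constant median m=l=u, ψ=2/m gives GPN=1/2 for every θ). ''The median'' is read as a unique conditional median. *)

(* Defs.v *)
From HB Require Import structures.
From mathcomp Require Export all_boot all_order all_algebra.
From mathcomp Require Export all_classical all_reals all_analysis.

Set Implicit Arguments.
Unset Strict Implicit.
Unset Printing Implicit Defensive.

Import Order.TTheory GRing.Theory Num.Theory.
Import numFieldNormedType.Exports.

Local Open Scope classical_set_scope.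
Local Open Scope ring_scope.

Section model.
Context {R : realType}.

Local Notation lebesgue2 := (@lebesgue_measure R \x @lebesgue_measure R)%E.

Definition is_density (f : R * R -> R) : Prop :=
  [/\ measurable_fun setT f,
      (forall x, 0 <= f x) &
      (\int[lebesgue2]_x (f x)%:E = 1)%E].

Definition Theta0 : set (R * R) := [set th | 0 < th.1 /\ th.1 <= th.2].

Definition quadrant : set (R * R) := [set x | 0 < x.1 /\ 0 < x.2].

Definition joint_pdf (f : R * R -> R) (th x : R * R) : R :=
  (th.1 * th.2)^-1 * f (x.1 / th.1, x.2 / th.2).

Definition pdfD (f : R * R -> R) (lam t : R) : \bar R :=
  (\int[lebesgue_measure]_(y in `]0%R, +oo[)
     (lam * y / t ^+ 2 * f (lam * y / t, y))%:E)%E.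

(* The integral defining [pdfD] may be infinite on a null set of [t]; the
   conditional density is undefined there, so such [t] are left out. *)
Definition suppD (f : R * R -> R) (lam : R) : set R :=
  [set t | 0 < t /\ (0 < pdfD f lam t < +oo)%E].

Definition cond_pdf (f : R * R -> R) (lam t s : R) : R :=
  lam * s / t ^+ 2 * f (lam * s / t, s) / fine (pdfD f lam t).

Definition is_median (f : R * R -> R) (lam t m : R) : Prop :=
  0 < m /\
  (\int[lebesgue_measure]_(s in `]0%R, m]) (cond_pdf f lam t s)%:E
     = (2^-1)%:E)%E.

(* "The" median: the distribution has exactly one. *)
Definition is_the_median (f : R * R -> R) (lam t m : R) : Prop :=
  is_median f lam t m /\ forall m', is_median f lam t m' -> m' = m.

(* Only the values of [W] on (0, +oo) matter. *)
Definition general_loss (W : R -> R) : Prop :=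
  [/\ (forall x, 0 < x -> 0 <= W x),
      W 1 = 0,
      {in `]0, 1[ &, forall x y, x < y -> W y < W x} &
      {in `]1, +oo[ &, forall x y, x < y -> W x < W y}].

Definition loss2 (W : R -> R) (th : R * R) (a : R) : R := W (a / th.2).

Definition equivariant (psi : R -> R) (x : R * R) : R :=
  psi (x.2 / x.1) * x.2.

Definition clip (l u psi : R -> R) (t : R) : R :=
  Num.max (u t)^-1 (Num.min (psi t) (l t)^-1).

Section random_vector.
Context {d : measure_display} {T : measurableType d}.
Variables (P : R * R -> probability T R) (X : T -> R * R).

Definition has_joint_pdf (f : R * R -> R) : Prop :=
  forall th, Theta0 th -> forall A : set (R * R), measurable A ->
    P th (X @^-1` A) = (\int[lebesgue2]_(x in A) (joint_pdf f th x)%:E)%E.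

(* The probability that X lies in E. As X is almost surely in the quadrant, and
   estimators are only specified there, E is first cut down to the quadrant;
   this keeps arbitrary values outside of it from affecting measurability. *)
Definition Pr (th : R * R) (E : set (R * R)) : \bar R :=
  P th (X @^-1` (quadrant `&` E)).

Definition GPN (W : R -> R) (delta1 delta2 : R * R -> R) (th : R * R)
    : \bar R :=
  (Pr th [set x | (loss2 W th (delta1 x) < loss2 W th (delta2 x))%R]
   + (2^-1)%:E *
     Pr th [set x | loss2 W th (delta1 x) = loss2 W th (delta2 x)])%E.

Definition nearer (W : R -> R) (delta1 delta2 : R * R -> R) : Prop :=
  (forall th, Theta0 th -> ((2^-1)%:E <= GPN W delta1 delta2 th)%E) /\
  (exists2 th, Theta0 th & ((2^-1)%:E < GPN W delta1 delta2 th)%E).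

End random_vector.
End model.

(* Main.v *)
(* Write Z = X_2 / th_2 and condition on D = t. If 1/u(t) exceeds psi(t), the
   clipped estimate 1/u(t) * X_2 is the better one as soon as Z <= u(t), hence
   with conditional probability at least 1/2 because u(t) is above the median;
   since the median is unique and W is continuous at 1, the better region
   extends beyond u(t) and carries more than half of the mass. The case
   psi(t) > 1/l(t) is symmetric. Integrating over t gives GPN >= 1/2, and
   equality would force psi to lie within its bounds almost surely. *)
Require Import Defs.
From mathcomp Require Import all_boot all_order all_algebra.
From mathcomp Require Import all_classical all_reals all_analysis.
From mathcomp Require Import measurable_realfun ring lra.
Import Order.TTheory GRing.Theory Num.Theory.
Import numFieldNormedType.Exports.
Local Open Scope classical_set_scope.
Local Open Scope ring_scope.

(** * Inversion and polar-type changes of variables *)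

(** The joint law of [D] and [Z_2] comes from the substitution x = (th_2 s / t, th_2 s). The
    integrands are merely measurable and nonnegative, so it is assembled from a one-dimensional
    inversion x = c / t valid for such functions, applied one coordinate at a time under Tonelli.
    Fiber masses are compared with half of the marginal density of [D] rather than normalised, so
    fibers of zero density are harmless; those of infinite density form a null set. A fiber on which
    clipping changes nothing consists of ties and contributes exactly half of its mass. Continuity
    at 1 excludes a jump of [W] just past 1, which could end the better region exactly at u(t) and
    leave it precisely half of the mass when u(t) is the median. *)

Lemma measurable_invr {R : realType} :
  measurable_fun setT (fun x : R => x^-1).
Proof.
(* By convention the inverse of 0 is 0, so cutting the function off at 0 does not change it;
   elsewhere it is continuous on an open set. *)
have -> : (fun x : R => x^-1) = (fun x : R => x^-1) \_ (~` [set 0]).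
  apply/funext => x; rewrite patchE; case: ifPn => // /negP.
  rewrite inE /= => /contrapT ->; by rewrite invr0.
apply: (iffLR (measurable_restrictT _ (measurableC (measurable_set1 (0 : R))))).
apply: open_continuous_measurable_fun.
  by rewrite -closedC setCK; exact: closed_eq.
by move=> x; rewrite inE /= => /eqP x0; exact: inv_continuous.
Qed.

(** The antiderivative - c / t equals - x at c / x and vanishes at infinity. This is the area
    computation behind the inversion below. *)
Lemma integral_inv_sq {R : realType} {c x : R} : 0 < c -> 0 < x ->
  (\int[lebesgue_measure]_(t in `[(c / x)%R, +oo[) (c / t ^+ 2)%:E = x%:E)%E.
Proof.
move=> c0 x0.
have cx0 : 0 < c / x by rewrite divr_gt0.
have dF (t : R) : 0 < t -> is_derive t 1 (fun s : R => - (c * s^-1)) (c / t ^+ 2).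
  move=> t0.
  have H := @is_deriveV R id t 1 1 (lt0r_neq0 t0) (is_derive_id t 1).
  have := is_deriveN (is_deriveZ c H).
  rewrite (_ : - (c *: _) = c / t ^+ 2) //=.
  by rewrite /GRing.scale /=; field; rewrite lt0r_neq0.
have cf (t : R) : 0 < t -> {for t, continuous (fun s : R => c / s ^+ 2)}.
  move=> t0; apply: cvgM; first exact: cvg_cst.
  apply: cvgV; first by rewrite expf_neq0// lt0r_neq0.
  by apply: (@exprn_continuous R).
rewrite (@ge0_continuous_FTC2y R (fun t => c / t ^+ 2)
  (fun s : R => - (c * s^-1)) (c / x) 0).
- rewrite EFinN oppeK add0e; congr EFin; field.
  by rewrite (lt0r_neq0 c0) lt0r_neq0.
- by move=> t _; rewrite divr_ge0 ?sqr_ge0// ltW.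
- apply: continuous_in_subspaceT => t; rewrite inE /= in_itv /= andbT => ct.
  by apply: cf; exact: lt_le_trans ct.
- rewrite -oppr0; apply: cvgN; rewrite -(mulr0 c).
  apply: cvgM; first exact: cvg_cst.
  apply: (iffRL (@gtr0_cvgV0 _ _ _ _ id _)); [exact: nbhs_pinfty_gt | exact: cvg_id].
- move=> t ct; have t0 : 0 < t by exact: lt_trans ct.
  exact: (@ex_derive _ _ _ _ _ _ _ (dF _ t0)).
- have : {for c / x, continuous (fun s : R => - (c * s^-1))}.
    apply/differentiable_continuous/derivable1_diffP.
    exact: (@ex_derive _ _ _ _ _ _ _ (dF _ cx0)).
  exact: cvg_at_right_filter.
- move=> t; rewrite in_itv /= andbT => ct.
  have t0 : 0 < t by exact: lt_trans ct.
  rewrite derive1E.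
  exact: (@derive_val _ _ _ _ _ _ _ (dF _ t0)).
Qed.

Lemma measurable_lt_set {d} {T : measurableType d} {R : realType} {D : set T}
    {f g : T -> R} : measurable D -> measurable_fun D f -> measurable_fun D g ->
  measurable (D `&` [set x | f x < g x]).
Proof.
move=> mD mf mg.
rewrite (_ : [set x | f x < g x] =
  [set x | ((EFin \o f) x < (EFin \o g) x)%E]); last first.
  by apply/seteqP; split => x /=; rewrite lte_fin.
by apply: measurable_lte => //; exact/measurable_EFinP.
Qed.

Section inversion.
Context {R : realType}.
Context {c : R} (c0 : 0 < c).
Local Notation mu := (@lebesgue_measure R).
Local Notation mu2 := (mu \x mu)%E.

(* The measure [c / t ^+ 2 dt] is the area under its own graph, so it needs no
   density construction: [phi] pushes that area forward along [t |-> c / t]. *)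
Let S : set (R * R) := [set z | 0 < z.1 /\ 0 < z.2 < c / z.1 ^+ 2].
Let phi (z : measurableTypeR R * measurableTypeR R) : measurableTypeR R :=
  c * z.1^-1 * \1_S z.

Let mS : measurable S.
Proof.
have mlt (g h : R * R -> R) : measurable_fun setT g -> measurable_fun setT h ->
    measurable [set z | g z < h z].
  by move=> mg mh; rewrite -[X in measurable X]setTI; exact: measurable_lt_set.
rewrite (_ : S = [set z | cst 0 z < z.1] `&`
    ([set z | cst 0 z < z.2] `&` [set z | z.2 < c / z.1 ^+ 2])); last first.
  apply/seteqP; split => z /=; first by move=> [? /andP[]].
  by move=> [? [? ?]]; split => //; apply/andP.
apply: measurableI; first exact: mlt.
apply: measurableI; first exact: mlt.
apply: mlt => //; apply: measurable_funM => //.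
apply: (measurableT_comp measurable_invr).
exact: measurable_funX.
Qed.

Let mphi : measurable_fun setT phi.
Proof.
suff : measurable_fun setT (phi : R * R -> R) by [].
apply: measurable_funM; last exact: measurable_indic.
apply: measurable_funM => //.
exact: (measurableT_comp measurable_invr).
Qed.

Let phi_gt0 : phi @^-1` `]0, +oo[ = S.
Proof.
apply/seteqP; split => z /=; rewrite in_itv /= andbT /phi indicE.
  by case: (boolP (z \in S)) => [/set_mem//|_]; rewrite mulr0 ltxx.
by move=> Sz; rewrite mem_set// mulr1; case: Sz => z0 _; rewrite divr_gt0.
Qed.

Let phi_lt x : 0 < x ->
  phi @^-1` `]0, x[ = [set z | c / x < z.1 /\ 0 < z.2 < c / z.1 ^+ 2].
Proof.
move=> x0; apply/seteqP; split => z /=; rewrite in_itv /= /phi indicE.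
  case: (boolP (z \in S)) => [/set_mem//|_]; last by rewrite mulr0 ltxx.
  rewrite mulr1 => -[z0 z2] /andP[_]; rewrite ltr_pdivrMr// => h.
  by split => //; rewrite ltr_pdivrMr// mulrC.
move=> [h z2]; have z0 : 0 < z.1 by apply: lt_trans h; rewrite divr_gt0.
rewrite mem_set// mulr1 divr_gt0//= ltr_pdivrMr//.
by move: h; rewrite ltr_pdivrMr// mulrC.
Qed.

(** The section of the region over t > c / x is an interval of length c / t ^+ 2, so its area is the
    integral computed in [integral_inv_sq]. *)
Let area x : 0 < x -> mu2 (phi @^-1` `]0, x[) = x%:E.
Proof.
move=> x0; rewrite phi_lt//.
have cx0 : 0 < c / x by rewrite divr_gt0.
rewrite -(integral_inv_sq c0 x0) -integral_itv_obnd_cbnd; last first.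
  apply/measurable_EFinP/measurable_funTS/measurable_funM => //.
  apply: (measurableT_comp measurable_invr).
  exact: measurable_funX.
rewrite [RHS]integral_mkcond /=; apply: eq_integral => t _ /=.
rewrite patchE; case: ifPn => [|].
  rewrite inE /= in_itv /= andbT => ht.
  rewrite (_ : xsection _ _ = `]0, c / t ^+ 2[%classic); last first.
    apply/seteqP; split => y; rewrite /xsection /= in_itv /= inE /=.
      by case.
    by [].
  rewrite lebesgue_measure_itv /= lte_fin divr_gt0 ?exprn_gt0//; last first.
    exact: lt_trans ht.
  by rewrite oppr0 adde0.
move=> ht; rewrite (_ : xsection _ _ = set0) ?measure0//.
apply/seteqP; split => y //; rewrite /xsection /= inE /= => -[h _].
by move/negP : ht; apply; rewrite inE /= in_itv /= h.
Qed.

Let m0 : measurable (`]0, +oo[%classic : set R).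
Proof. exact: measurable_itv. Qed.

(** Both measures agree and are finite on the rays below x, a generating family closed under
    intersection. They must first be restricted to the positive half-line: [phi] sends everything
    outside [S] to 0, which would give the pushforward an infinite atom there. *)
Let mu_phi (A : set R) : measurable A -> A `<=` `]0, +oo[ ->
  mu A = pushforward mu2 phi A.
Proof.
move=> mA A0.
pose m1 : {measure set (measurableTypeR R) -> \bar R} := mrestr mu m0.
(* Unification cannot produce the side proof [mphi], so the instance is named. *)
pose nu : {measure set (measurableTypeR R) -> \bar R} :=
  measure_function_pushforward__canonical__measure_function_Measure mu2 mphi.
pose m2 : {measure set (measurableTypeR R) -> \bar R} := mrestr nu m0.
have ray x : m1 `]-oo, x[%classic = m2 `]-oo, x[%classic /\
    (m1 `]-oo, x[%classic < +oo)%E.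
  rewrite /m1 /m2 /= /mrestr (_ : `]-oo, x[ `&` `]0, +oo[ = `]0, x[%classic); last first.
    apply/seteqP; split => y /=; rewrite !in_itv /= andbT; first by move=> [-> ->].
    by move=> /andP[-> ->].
  rewrite lebesgue_measure_itv /= lte_fin.
  case: ltP => x0; last by rewrite set_itv_ge ?measure0// -leNgt.
  by rewrite /nu /= /pushforward area// oppr0 adde0 ltry.
have -> : mu A = m1 A by rewrite /m1 /= /mrestr setIidl.
have -> : pushforward mu2 phi A = m2 A by rewrite /m2 /= /mrestr setIidl.
apply: (@measure_unique _ R (measurableTypeR R) (@RGenInftyO.G R)
  (fun k => `]-oo, k%:R[%classic) _ _ _ _ m1 m2).
- exact: RGenInftyO.measurableE.
- move=> _ _ [x ->] [y ->]; exists (Num.min x y).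
  by apply/seteqP; split => z /=; rewrite !in_itv /= lt_min => /andP.
- by move=> k; exists k%:R.
- apply/seteqP; split => // x _; exists (Num.bound `|x|) => //=.
  rewrite in_itv /=; apply: le_lt_trans (ler_norm x) _.
  exact: archi_boundP.
- by move=> _ [x ->]; exact: (ray x).1.
- by move=> k; exact: (ray _).2.
- exact: mA.
Qed.

(** Integrating against the pushforward gives the integral of g(c / z.1) over [S]. By Tonelli the
    integrand is constant along each vertical section, and the length of the section supplies the
    Jacobian. *)
Lemma ge0_integral_inversion {g : R -> \bar R} : measurable_fun setT g ->
  (forall x, 0 <= g x)%E ->
  (\int[mu]_(x in `]0%R, +oo[) g x =
   \int[mu]_(t in `]0%R, +oo[) (g (c / t)%R * (c / t ^+ 2)%:E))%E.
Proof.
move=> mg g0.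
rewrite (eq_measure_integral
  (measure_function_pushforward__canonical__measure_function_Measure mu2 mphi));
  last by move=> A mA A0; exact: mu_phi.
rewrite /= (ge0_integral_pushforward mphi) //; last exact: measurable_funTS.
rewrite phi_gt0 integral_mkcond fubini_tonelli1; last 2 first.
- apply: (iffLR (measurable_restrictT _ mS)).
  by apply: measurable_funTS; exact: measurableT_comp.
- by move=> z; apply: erestrict_ge0 => ? _; exact: g0.
rewrite [RHS]integral_mkcond /=; apply: eq_integral => t _.
rewrite /fubini_F patchE; case: ifPn => [|].
  rewrite inE /= in_itv /= andbT => t0.
  transitivity (\int[mu]_(y in `]0%R, (c / t ^+ 2)%R[) cst (g (c / t)%R) y)%E.
    rewrite [RHS]integral_mkcond /=; apply: eq_integral => y _.
    rewrite !patchE /= /phi indicE.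
    have [yS|yS] := boolP (0 < y < c / t ^+ 2).
      have -> : (t, y) \in S by apply: mem_set; split.
      by rewrite mem_set ?mulr1//= in_itv.
    have -> : ((t, y) \in S) = false by apply: memNset => -[_ h]; rewrite h in yS.
    by rewrite memNset//= in_itv; exact/negP.
  rewrite integral_cst//=; congr (_ * _)%E.
  rewrite lebesgue_measure_itv /= lte_fin divr_gt0 ?exprn_gt0//.
  by rewrite oppr0 adde0.
move=> t0; apply: integral0_eq => y _; rewrite patchE; case: ifPn => //.
rewrite inE => -[/= t1 _]; move/negP : t0; case.
by rewrite inE /= in_itv /= t1.
Qed.

End inversion.

(** * Tonelli on rectangles and the substitution in the quadrant *)

Section tonelli_rectangle.
Context {d1 d2} {T1 : measurableType d1} {T2 : measurableType d2} {R : realType}.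
Variables (m1 : {sigma_finite_measure set T1 -> \bar R}).
Variables (m2 : {sigma_finite_measure set T2 -> \bar R}).
Variables (A : set T1) (B : set T2) (F : T1 * T2 -> \bar R).
Hypotheses (mA : measurable A) (mB : measurable B).
Hypotheses (mF : measurable_fun setT F) (F0 : forall z, (0 <= F z)%E).

Let mFAB : measurable_fun setT (F \_ (A `*` B)).
Proof.
apply: (iffLR (measurable_restrictT _ (measurableX mA mB))).
exact: measurable_funTS.
Qed.

Let FAB0 z : (0 <= (F \_ (A `*` B)) z)%E.
Proof. by apply: erestrict_ge0 => ? _; exact: F0. Qed.

Lemma tonelli_rectangle1 :
  (\int[m1 \x m2]_(z in A `*` B) F z =
   \int[m1]_(x in A) \int[m2]_(y in B) F (x, y))%E.
Proof.
rewrite integral_mkcond fubini_tonelli1// [RHS]integral_mkcond.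
apply: eq_integral => x _; rewrite /fubini_F patchE; case: ifPn => [Ax|Ax].
  rewrite [RHS]integral_mkcond; apply: eq_integral => y _.
  by rewrite !patchE in_setX/= Ax.
by apply: integral0_eq => y _; rewrite patchE in_setX/= (negbTE Ax).
Qed.

Lemma tonelli_rectangle2 :
  (\int[m1 \x m2]_(z in A `*` B) F z =
   \int[m2]_(y in B) \int[m1]_(x in A) F (x, y))%E.
Proof.
rewrite integral_mkcond fubini_tonelli2// [RHS]integral_mkcond.
apply: eq_integral => y _; rewrite /fubini_G patchE; case: ifPn => [By|By].
  rewrite [RHS]integral_mkcond; apply: eq_integral => x _.
  by rewrite !patchE in_setX/= By andbT.
by apply: integral0_eq => x _; rewrite patchE in_setX/= (negbTE By) andbF.
Qed.
End tonelli_rectangle.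

Section partial_integral.
Context {d1 d2} {T1 : measurableType d1} {T2 : measurableType d2} {R : realType}.

Lemma measurable_fun_integral_snd (m2 : {sigma_finite_measure set T2 -> \bar R})
    (B : set T2) (F : T1 * T2 -> \bar R) : measurable B ->
  measurable_fun setT F -> (forall z, (0 <= F z)%E) ->
  measurable_fun setT (fun x => \int[m2]_(y in B) F (x, y))%E.
Proof.
move=> mB mF F0.
rewrite (_ : (fun x => _) = fubini_F m2 (F \_ (setT `*` B))); last first.
  apply/funext => x; rewrite /fubini_F [LHS]integral_mkcond; apply: eq_integral => y _.
  by rewrite !patchE in_setX/= in_setT.
apply: measurable_fun_fubini_tonelli_F.
  apply: (iffLR (measurable_restrictT _ (measurableX measurableT mB))).
  exact: measurable_funTS.
by move=> z; apply: erestrict_ge0 => ? _; exact: F0.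
Qed.

Lemma measurable_fun_integral_fst (m1 : {sigma_finite_measure set T1 -> \bar R})
    (A : set T1) (F : T1 * T2 -> \bar R) : measurable A ->
  measurable_fun setT F -> (forall z, (0 <= F z)%E) ->
  measurable_fun setT (fun y => \int[m1]_(x in A) F (x, y))%E.
Proof.
move=> mA mF F0.
rewrite (_ : (fun y => _) = fubini_G m1 (F \_ (A `*` setT))); last first.
  apply/funext => y; rewrite /fubini_G [LHS]integral_mkcond; apply: eq_integral => x _.
  by rewrite !patchE in_setX/= in_setT andbT.
apply: measurable_fun_fubini_tonelli_G.
  apply: (iffLR (measurable_restrictT _ (measurableX mA measurableT))).
  exact: measurable_funTS.
by move=> z; apply: erestrict_ge0 => ? _; exact: F0.
Qed.
End partial_integral.

(** A scaling is two inversions, with constants k and 1: k / (1 / s) = k s, and the Jacobians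
    multiply to k. *)
Lemma ge0_integral_scaling {R : realType} {k : R} {g : R -> \bar R} : 0 < k ->
  measurable_fun setT g -> (forall x, 0 <= g x)%E ->
  (\int[lebesgue_measure]_(x in `]0%R, +oo[) g x =
   \int[lebesgue_measure]_(s in `]0%R, +oo[) (g (k * s)%R * k%:E))%E.
Proof.
move=> k0 mg g0; rewrite (ge0_integral_inversion k0)//.
rewrite (ge0_integral_inversion (@ltr01 R)).
- apply: eq_integral => s; rewrite inE /= in_itv /= andbT => s0.
  rewrite -muleA -EFinM; congr (g _ * _%:E)%E; field; by rewrite lt0r_neq0.
- apply: emeasurable_funM.
    apply: (measurableT_comp mg); apply: measurable_funM => //.
    exact: measurable_invr.
  apply/measurable_EFinP/measurable_funM => //.
  apply: (measurableT_comp measurable_invr); exact: measurable_funX.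
- move=> t; rewrite mule_ge0// lee_fin divr_ge0 ?sqr_ge0//; exact: ltW.
Qed.

(* The absolute value makes the Jacobian nonnegative on the whole plane. *)
Definition ratio_scale_integrand {R : realType} (k : R) (G : R * R -> \bar R)
    (z : R * R) :=
  (G (k * z.2 / z.1, k * z.2)%R * (k ^+ 2 * `|z.2| / z.1 ^+ 2)%:E)%E.

Lemma measurable_ratio_scale {R : realType} {k : R} {G : R * R -> \bar R} :
  measurable_fun setT G -> measurable_fun setT (ratio_scale_integrand k G).
Proof.
move=> mG; apply: emeasurable_funM.
  apply: (measurableT_comp mG); apply/measurable_fun_pair => /=.
    apply: measurable_funM; first exact: measurable_funM.
    exact: (measurableT_comp measurable_invr).
  exact: measurable_funM.
apply/measurable_EFinP/measurable_funM.
  apply: measurable_funM => //.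
  exact: measurableT_comp.
apply: (measurableT_comp measurable_invr); exact: measurable_funX.
Qed.

Lemma ratio_scale_ge0 {R : realType} {k : R} {G : R * R -> \bar R} :
  (forall x, 0 <= G x)%E -> forall z, (0 <= ratio_scale_integrand k G z)%E.
Proof.
move=> G0 z; apply: mule_ge0; first exact: G0.
by rewrite lee_fin divr_ge0 ?sqr_ge0// mulr_ge0 ?sqr_ge0.
Qed.

(** The second coordinate is scaled by x_2 = k s; then, for fixed s, the first is inverted by x_1 =
    k s / t. The Jacobian is k times k s / t ^+ 2. The inversion needs s on the outside, so the
    order of integration is exchanged before and after it. *)
Lemma ge0_integral_ratio_scale {R : realType} {k : R} {G : R * R -> \bar R} :
  0 < k -> measurable_fun setT G -> (forall x, 0 <= G x)%E ->
  (\int[(@lebesgue_measure R) \x (@lebesgue_measure R)]_(x in quadrant) G x =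
   \int[lebesgue_measure]_(t in `]0%R, +oo[)
   \int[lebesgue_measure]_(s in `]0%R, +oo[)
     (G (k * s / t, k * s)%R * (k ^+ 2 * s / t ^+ 2)%:E))%E.
Proof.
move=> k0 mG G0.
pose D : set (measurableTypeR R) := `]0, +oo[%classic.
have mD : measurable D by exact: measurable_itv.
have -> : (@quadrant R) = D `*` D.
  by apply/seteqP; split => z /=; rewrite /D /= !in_itv /= !andbT.
rewrite tonelli_rectangle2//.
have mI := @measurable_fun_integral_fst _ _ (measurableTypeR R) (measurableTypeR R) R
  lebesgue_measure D G mD mG G0.
have I0 (y : R) : (0 <= \int[lebesgue_measure]_(x in D) G (x, y))%E.
  by apply: integral_ge0 => x _; exact: G0.
rewrite (ge0_integral_scaling k0 mI I0).
pose H : measurableTypeR R * measurableTypeR R -> \bar R :=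
  ratio_scale_integrand k G.
have mH : measurable_fun setT H.
  exact: (@measurable_ratio_scale R k G mG).
have H0 z : (0 <= H z)%E := ratio_scale_ge0 G0 z.
transitivity (\int[lebesgue_measure]_(s in D) \int[lebesgue_measure]_(t in D) H (t, s))%E.
  apply: eq_integral => s; rewrite inE /D /= in_itv /= andbT => s0.
  have mGs : measurable_fun setT (fun x : R => G (x, k * s)).
    exact: measurableT_comp.
  rewrite (ge0_integral_inversion (mulr_gt0 k0 s0) mGs)//.
  rewrite -ge0_integralZr//; last 3 first.
  - apply: measurable_funTS; apply: emeasurable_funM.
      apply: (measurableT_comp mGs); apply: measurable_funM => //.
      exact: measurable_invr.
    apply/measurable_EFinP/measurable_funM => //.
    apply: (measurableT_comp measurable_invr); exact: measurable_funX.
  - move=> t; rewrite /D /= in_itv/= andbT => t0; apply: mule_ge0; first exact: G0.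
    by rewrite lee_fin divr_ge0 ?sqr_ge0// mulr_ge0// ltW.
  - by rewrite lee_fin ltW.
  apply: eq_integral => t; rewrite inE /= in_itv /= andbT => t0.
  rewrite -muleA -EFinM /H /ratio_scale_integrand /= gtr0_norm//; congr (_ * _%:E)%E.
  by field; rewrite lt0r_neq0.
have <- : (\int[lebesgue_measure \x lebesgue_measure]_(z in D `*` D) H z =
  \int[lebesgue_measure]_(s in D) \int[lebesgue_measure]_(t in D) H (t, s))%E.
  exact: (tonelli_rectangle2 lebesgue_measure lebesgue_measure D D H mD mD mH H0).
rewrite (tonelli_rectangle1 lebesgue_measure lebesgue_measure D D H mD mD mH H0).
apply: eq_integral => t; rewrite inE /D /= in_itv /= andbT => t0.
apply: eq_integral => s; rewrite inE /= in_itv /= andbT => s0.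
by rewrite /H /ratio_scale_integrand /= gtr0_norm.
Qed.

(** * Disintegration along D *)

(* The joint density of (D, Z_2) at (t, s); dividing it by [pdfD] gives
   [cond_pdf]. *)
Definition ratio_scale_pdf {R : realType} (f : R * R -> R) (lam t s : R) : R :=
  lam * s / t ^+ 2 * f (lam * s / t, s).

Section disintegration.
Context {R : realType} {d : measure_display} {T : measurableType d}.
Context {f : R * R -> R} {P : R * R -> probability T R} {X : T -> R * R}.
Hypotheses (f_density : is_density f) (X_pdf : has_joint_pdf P X f).
Variables (th : R * R) (th_in : Theta0 th) (E : set (R * R)).
Hypothesis mE : measurable (quadrant `&` E).

Local Notation fiber t :=
  (`]0, +oo[ `&` [set s | E (th.2 * s / t, th.2 * s)]).
Local Notation mass t := (\int[lebesgue_measure]_(s in fiber t)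
  (ratio_scale_pdf f (th.2 / th.1) t s)%:E)%E.

Let th1_gt0 : 0 < th.1. Proof. by case: th_in. Qed.
Let th2_gt0 : 0 < th.2. Proof. by case: th_in => h; exact: lt_le_trans. Qed.

(** Putting the event into the integrand makes every fiber mass a partial integral of one function
    on the plane, whence its measurability in t. *)
Let G : R * R -> \bar R := (EFin \o joint_pdf f th) \_ (quadrant `&` E).

Let mG : measurable_fun setT G.
Proof.
apply: (iffLR (measurable_restrictT _ mE)); apply: measurable_funTS.
apply/measurable_EFinP/measurable_funM => //.
case: f_density => mf _ _; apply: (measurableT_comp mf).
by apply/measurable_fun_pair => /=; exact: measurable_funM.
Qed.

Let G0 x : (0 <= G x)%E.
Proof.
apply: erestrict_ge0 => z _; rewrite lee_fin mulr_ge0//.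
  by rewrite invr_ge0 mulr_ge0// ltW.
by case: f_density.
Qed.

(** At x = (th_2 s / t, th_2 s) the arguments of [f] become (lam s / t, s), and (th_1 th_2)^-1 times
    the Jacobian th_2^2 s / t^2 is lam s / t^2 with lam = th_2 / th_1. *)
Let massE t : 0 < t -> mass t =
  (\int[lebesgue_measure]_(s in `]0%R, +oo[)
    ratio_scale_integrand th.2 G (t, s))%E.
Proof.
move=> t0; rewrite integral_mkcondr; apply: eq_integral => s.
rewrite inE /= in_itv /= andbT => s0; rewrite /ratio_scale_integrand /= /G !patchE.
have Q : quadrant (th.2 * s / t, th.2 * s).
  by split => /=; rewrite ?divr_gt0 ?mulr_gt0.
case: ifPn => [Es|Es].
  rewrite mem_set; last by split => //; exact: set_mem Es.
  rewrite /ratio_scale_pdf /= /joint_pdf /= gtr0_norm// -EFinM; congr EFin.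
  have -> : th.2 * s / t / th.1 = th.2 / th.1 * s / t.
    by field; rewrite !lt0r_neq0.
  have -> : th.2 * s / th.2 = s by field; rewrite lt0r_neq0.
  by field; rewrite !lt0r_neq0.
by rewrite memNset ?mul0e// => -[_ h]; move/negP: Es; apply; rewrite mem_set.
Qed.

Lemma measurable_fiber_mass :
  measurable_fun (`]0, +oo[%classic : set (measurableTypeR R)) (fun t => mass t).
Proof.
apply: (@eq_measurable_fun _ _ _ _ _ (fun t => \int[lebesgue_measure]_(s in `]0%R, +oo[)
    ratio_scale_integrand th.2 G (t, s))%E).
  by move=> t; rewrite inE /= in_itv /= andbT => /massE.
apply: measurable_funTS.
apply: (@measurable_fun_integral_snd _ _ (measurableTypeR R) (measurableTypeR R) R
  lebesgue_measure _ (ratio_scale_integrand th.2 G)) => //.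
- exact: measurable_ratio_scale.
- exact: ratio_scale_ge0.
Qed.

Lemma Pr_disintegration :
  Pr P X th E = (\int[lebesgue_measure]_(t in `]0%R, +oo[) mass t)%E.
Proof.
(* The quadrant is duplicated: one copy remains the domain of integration, the other goes with [E]
   into the integrand [G]. *)
rewrite /Pr X_pdf// -[in LHS](setIid quadrant) -setIA integral_mkcondr.
rewrite -/G (ge0_integral_ratio_scale th2_gt0 mG G0).
apply: eq_integral => t; rewrite inE /= in_itv /= andbT => t0.
rewrite massE//; apply: eq_integral => s; rewrite inE /= in_itv /= andbT => s0.
by rewrite /ratio_scale_integrand /= gtr0_norm.
Qed.

End disintegration.

(** * Comparison of losses *)

(** Preimages of upper rays under a monotone function are convex, hence intervals. *)
Lemma measurable_fun_nondecreasing_itv {R : realType} {i : interval R} {f : R -> R} :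
  {in i &, {homo f : x y / x <= y}} -> measurable_fun [set` i] f.
Proof.
move=> f_nd; apply: (measurability (@RGenCInfty.G R)) => [|/= _ [_] [r] -> <-].
  exact: RGenCInfty.measurableE.
apply: is_interval_measurable => s t /= [si rs] [ti _] u /andP[su ut].
have ui : u \in i by apply: (interval_is_interval si ti); rewrite su ut.
split => //; move: rs; rewrite /= !in_itv/= !andbT => rs.
by apply: (le_trans rs); exact: f_nd.
Qed.

Section loss.
Context {R : realType} {W : R -> R} (W_loss : general_loss W).

(** [general_loss] gives monotonicity only on the open interval; the endpoint 1 is reached through a
    midpoint z, as W 1 = 0 <= W z < W x. *)
Lemma loss_decreasing (x y : R) : 0 < x -> x < y -> y <= 1 -> W y < W x.
Proof.
case: W_loss => W0 W1 Wdec _ x0 xy; rewrite le_eqVlt => /predU1P[y1|y1].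
  subst y; pose z := (x + 1) / 2.
  have xz : x < z by rewrite /z; lra.
  have z1 : z < 1 by rewrite /z; lra.
  rewrite W1; apply: (@le_lt_trans _ _ (W z)); first by apply: W0; lra.
  by apply: Wdec => //; rewrite in_itv /=; lra.
by apply: Wdec => //; rewrite in_itv /=; lra.
Qed.

Lemma loss_increasing (x y : R) : 1 <= x -> x < y -> W x < W y.
Proof.
case: W_loss => W0 W1 _ Winc; rewrite le_eqVlt => /predU1P[x1|x1] xy.
  subst x; pose z := (1 + y) / 2.
  have yz : z < y by rewrite /z; lra.
  have z1 : 1 < z by rewrite /z; lra.
  rewrite W1; apply: (@le_lt_trans _ _ (W z)); first by apply: W0; lra.
  by apply: Winc => //; rewrite in_itv /=; lra.
by apply: Winc => //; rewrite in_itv /=; lra.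
Qed.

Hypothesis W_cont1 : {for 1, continuous W}.

(** Continuity at 1 enters here, together with W 1 = 0. *)
Let near1 (y : R) : 0 < W y ->
  exists2 e : R, 0 < e & forall z : R, `|z - 1| < e -> W z < W y.
Proof.
case: W_loss => _ W1 _ _ Wy.
have /W_cont1 [e e0 he] : nbhs (W 1) [set w | w < W y].
  rewrite W1; exists (W y) => //= w.
  by rewrite /ball_ /= sub0r normrN; exact: le_lt_trans (ler_norm w).
by exists e => // z ze; apply: he; rewrite /ball_ /= distrC.
Qed.

(** While a s <= 1, both arguments lie on the decreasing branch. Slightly beyond, a s is so close to
    1 that its loss is below that of y, the midpoint of b / a and 1, while b s is still at most
    y. *)
Lemma loss_lt_of_larger_factor (a b : R) : 0 < b -> b < a ->
  exists2 m, a^-1 < m & forall s, 0 < s -> s <= m -> W (a * s) < W (b * s).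
Proof.
move=> b0 ba; have a0 : 0 < a by exact: lt_trans ba.
have r1 : b / a < 1 by rewrite ltr_pdivrMr// mul1r.
have r0 : 0 < b / a by rewrite divr_gt0.
set r := b / a in r0 r1; pose y := (1 + r) / 2.
have y1 : y < 1 by rewrite /y; lra.
have Wy : 0 < W y.
  by case: W_loss => _ <- _ _; apply: loss_decreasing => //; rewrite /y; lra.
have [e e0 We] := near1 _ Wy.
(* The first bound keeps a s within e of 1; the second gives r (1 + del) <= y, because r < 1. *)
pose del := Num.min (e / 2) ((1 - r) / 2).
have del0 : 0 < del by rewrite lt_min; apply/andP; split; lra.
have dele : del <= e / 2 by rewrite ge_min lexx.
have delr : del <= (1 - r) / 2 by rewrite ge_min lexx orbT.
have bE : b = r * a by rewrite /r divfK// lt0r_neq0.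
exists ((1 + del) / a).
  by rewrite -[ltLHS]mul1r ltr_pM2r ?invr_gt0//; lra.
move=> s s0; rewrite ler_pdivlMr// mulrC => sm.
have as0 : 0 < a * s by rewrite mulr_gt0.
have bsE : b * s = r * (a * s) by rewrite bE mulrA.
have [as1|as1] := leP (a * s) 1.
  by apply: loss_decreasing => //; rewrite ?mulr_gt0 ?ltr_pM2r.
have bsy : b * s <= y by rewrite bsE /y; nra.
apply: (@lt_le_trans _ _ (W y)).
  by apply: We; rewrite ger0_norm; lra.
move: bsy; rewrite le_eqVlt => /predU1P[->//|bsy]; apply/ltW/loss_decreasing => //.
  by rewrite mulr_gt0.
exact: ltW.
Qed.

Lemma loss_lt_of_smaller_factor (a b : R) : 0 < a -> a < b ->
  exists2 m, 0 < m < a^-1 & forall s, m < s -> W (a * s) < W (b * s).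
Proof.
move=> a0 ab; have b0 : 0 < b by exact: lt_trans ab.
have r1 : 1 < b / a by rewrite ltr_pdivlMr// mul1r.
set r := b / a in r1; pose y := (1 + r) / 2.
have y1 : 1 < y by rewrite /y; lra.
have Wy : 0 < W y.
  by case: W_loss => _ <- _ _; apply: loss_increasing.
have [e e0 We] := near1 _ Wy.
(* Here r > 1 magnifies the shift, hence the division by r: r (1 - del) >= y. It also yields del <
   1, so the threshold stays positive. *)
pose del := Num.min (e / 2) ((r - 1) / (2 * r)).
have q0 : 0 < (r - 1) / (2 * r) by rewrite divr_gt0; lra.
have del0 : 0 < del by rewrite lt_min; apply/andP; split; lra.
have dele : del <= e / 2 by rewrite ge_min lexx.
have delr : del * r <= (r - 1) / 2.
  have -> : (r - 1) / 2 = (r - 1) / (2 * r) * r by field; lra.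
  by rewrite ler_pM2r ?ge_min ?lexx ?orbT//; lra.
have bE : b = r * a by rewrite /r divfK// lt0r_neq0.
have del1 : del < 1 by nra.
exists ((1 - del) / a).
  rewrite divr_gt0//=; last by lra.
  by rewrite -[ltRHS]mul1r ltr_pM2r ?invr_gt0//; lra.
move=> s; rewrite ltr_pdivrMr// mulrC => sm.
have s0 : 0 < s by rewrite -(pmulr_rgt0 _ a0); lra.
have bsE : b * s = r * (a * s) by rewrite bE mulrA.
have [as1|as1] := leP 1 (a * s).
  by apply: loss_increasing => //; rewrite ltr_pM2r.
have bsy : y <= b * s by rewrite bsE /y; nra.
apply: (@lt_le_trans _ _ (W y)).
  by apply: We; rewrite ltr0_norm; lra.
move: bsy; rewrite le_eqVlt => /predU1P[->//|bsy].
by apply/ltW/loss_increasing => //; exact: ltW.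
Qed.

(** Measurability of [W] follows from its monotonicity on either side of 1. *)
Lemma measurable_loss : measurable_fun (`]0, +oo[%classic : set R) W.
Proof.
have -> : `]0, +oo[%classic = `]0, 1] `|` `]1, +oo[ :> set R.
  by rewrite -itv_bndbnd_setU// bnd_simp.
apply/measurable_funU => //; split.
  rewrite -[W]opprK; apply: measurable_funN.
  apply: measurable_fun_nondecreasing_itv => x y.
  rewrite !in_itv/= => /andP[x0 _] /andP[_ y1].
  by rewrite le_eqVlt => /predU1P[->//|xy]; rewrite lerN2 ltW// loss_decreasing.
apply: measurable_fun_nondecreasing_itv => x y.
rewrite !in_itv/= !andbT => x1 _.
by rewrite le_eqVlt => /predU1P[->//|xy]; rewrite ltW// loss_increasing// ltW.
Qed.

End loss.

(** * The conditional median *)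

Section median.
Context {R : realType} {f : R * R -> R} (f_density : is_density f).
Context {lam t : R} (lam_gt0 : 0 < lam) (t_supp : suppD f lam t).
Local Notation mass A :=
  (\int[lebesgue_measure]_(s in A) (ratio_scale_pdf f lam t s)%:E)%E.

Let t_gt0 : 0 < t. Proof. by case: t_supp. Qed.

Lemma measurable_ratio_scale_pdf : measurable_fun setT (ratio_scale_pdf f lam t).
Proof.
apply: measurable_funM; first by apply: measurable_funM => //; exact: measurable_funM.
case: f_density => mf _ _; apply: (measurableT_comp mf).
by apply/measurable_fun_pair => //=; apply: measurable_funM => //; exact: measurable_funM.
Qed.

Lemma ratio_scale_pdf_ge0 (s : R) : 0 < s -> 0 <= ratio_scale_pdf f lam t s.
Proof.
move=> s0; apply: mulr_ge0; last by case: f_density.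
by rewrite divr_ge0 ?sqr_ge0// mulr_ge0// ltW.
Qed.

Let mpdf (A : set (measurableTypeR R)) :
  measurable_fun A (fun s => (ratio_scale_pdf f lam t s)%:E).
Proof.
by apply/measurable_funTS/measurable_EFinP; exact: measurable_ratio_scale_pdf.
Qed.

Lemma le_mass (A B : set (measurableTypeR R)) : measurable A -> measurable B ->
  A `<=` B -> B `<=` `]0, +oo[ -> (mass A <= mass B)%E.
Proof.
move=> mA mB AB B0; apply: ge0_subset_integral => //.
by move=> s /B0; rewrite /= in_itv /= andbT lee_fin; exact: ratio_scale_pdf_ge0.
Qed.

Let p := fine (pdfD f lam t).

Let p_gt0 : 0 < p.
Proof. by case: t_supp => _ /andP[? ?]; rewrite fine_gt0//; apply/andP. Qed.

Lemma massT : mass (`]0%R, +oo[%classic : set R) = p%:E.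
Proof.
case: t_supp => _ /andP[p0 poo].
by rewrite /p fineK// ge0_fin_numE// ltW.
Qed.

Lemma is_medianP (m : R) : is_median f lam t m <->
  0 < m /\ mass (`]0%R, m]%classic : set R) = (p / 2)%:E.
Proof.
rewrite /is_median.
have -> : (\int[lebesgue_measure]_(s in `]0%R, m]) (cond_pdf f lam t s)%:E =
    mass (`]0%R, m]%classic : set R) * (p^-1)%:E)%E.
  rewrite -ge0_integralZr//=.
  - by move=> s; rewrite in_itv /= lee_fin => /andP[s0 _]; exact: ratio_scale_pdf_ge0.
  - by rewrite lee_fin invr_ge0 ltW.
(* The bound by p makes the mass a real number, so the factor p^-1 can be cleared. *)
have ple : (mass (`]0%R, m]%classic : set R) <= p%:E)%E.
  rewrite -massT; apply: le_mass => // s /=.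
  by rewrite !in_itv /= andbT => /andP[].
have : (0 <= mass (`]0%R, m]%classic : set R))%E.
  apply: integral_ge0 => s /=; rewrite in_itv /= lee_fin => /andP[s0 _].
  exact: ratio_scale_pdf_ge0.
case: (mass _) ple => [r _ _|//|//].
split=> -[m0 [e]]; split => //; rewrite -?EFinM; congr EFin.
  by rewrite -e mulrC divfK// lt0r_neq0.
by rewrite e; field; rewrite lt0r_neq0.
Qed.

Section unique.
Context {m : R} (m_med : is_the_median f lam t m).

Let m_gt0 : 0 < m. Proof. by case: m_med => -[]. Qed.
Let massm : mass (`]0%R, m]%classic : set R) = (p / 2)%:E.
Proof. by case: m_med => /is_medianP[]. Qed.

Let mass_neq m' : 0 < m' -> m' != m ->
  mass (`]0%R, m']%classic : set R) != (p / 2)%:E.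
Proof.
move=> m'0; apply: contra_neq => e; case: m_med => _; apply.
exact/is_medianP.
Qed.

(** Monotonicity gives at least half; equality would make m' a second median. *)
Lemma mass_gt_median m' : m < m' ->
  ((p / 2)%:E < mass (`]0%R, m']%classic : set R))%E.
Proof.
move=> mm'; have m'0 := lt_trans m_gt0 mm'.
rewrite lt_neqAle eq_sym mass_neq ?gt_eqF//= -massm.
apply: le_mass => // s /=; rewrite !in_itv /= ?andbT => /andP[->] //.
by move=> sm; rewrite (le_trans sm)// ltW.
Qed.

(** By uniqueness the mass up to m' is strictly below half, and the rest of the finite total p lies
    beyond m'. *)
Lemma mass_lt_median m' : 0 < m' < m ->
  ((p / 2)%:E < mass (`]m', +oo[%classic : set R))%E.
Proof.
move=> /andP[m'0 mm'].
have lt_half : (mass (`]0%R, m']%classic : set R) < (p / 2)%:E)%E.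
  rewrite lt_neqAle mass_neq ?lt_eqF//= -massm.
  apply: le_mass => // s /=; rewrite !in_itv /= ?andbT => /andP[->] //.
  by move=> sm; rewrite (le_trans sm)// ltW.
have : (mass (`]0%R, m']%classic : set R) + mass (`]m', +oo[%classic : set R) = p%:E)%E.
  have U : `]0, m'] `|` `]m', +oo[ = `]0, +oo[%classic :> set R.
    by rewrite -itv_bndbnd_setU// bnd_simp ltW.
  rewrite -massT -U; apply/esym; apply: ge0_integral_setU => //.
    rewrite U => s; rewrite /= in_itv /= andbT lee_fin.
    exact: ratio_scale_pdf_ge0.
  apply/disj_setPS => s [] /=; rewrite !in_itv /= andbT => /andP[_ sm] ms.
  by move: sm; rewrite leNgt ms.
have mass0 (A : set R) : A `<=` `]0, +oo[ -> (0 <= mass A)%E.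
  move=> A0; apply: integral_ge0 => s /A0 /=; rewrite in_itv /= andbT lee_fin.
  exact: ratio_scale_pdf_ge0.
have : (0 <= mass (`]0%R, m']%classic : set R))%E.
  by apply: mass0 => s /=; rewrite !in_itv /= andbT => /andP[].
case: (mass (`]0%R, m']%classic : set R)) lt_half => [r|//|//].
case: (mass (`]m', +oo[%classic : set R)) => [q|//|//].
rewrite !lte_fin => rp _ [] e; lra.
Qed.
End unique.
End median.

(** F - G is nonnegative almost everywhere with integral at most 0, so its absolute value integrates
    to 0. The finite integral of G makes both functions integrable, so subtraction of infinite
    values occurs only on a null set. *)
Lemma ae_eq_of_ge0_integral_le {d} {T : measurableType d} {R : realType}
    {mu : {measure set T -> \bar R}} {D : set T} {F G : T -> \bar R} :
  measurable D -> measurable_fun D F -> measurable_fun D G ->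
  (forall x, D x -> 0 <= F x)%E -> (forall x, D x -> 0 <= G x)%E ->
  (\int[mu]_(x in D) G x < +oo)%E ->
  {ae mu, forall x, D x -> (G x <= F x)%E} ->
  (\int[mu]_(x in D) F x <= \int[mu]_(x in D) G x)%E ->
  ae_eq mu D F G.
Proof.
move=> mD mF mG F0 G0 Goo GF FG.
have iG : mu.-integrable D G.
  apply/integrableP; split => //; under eq_integral => x Dx.
    rewrite gee0_abs ?G0//; last exact: set_mem.
    over.
  by [].
have iF : mu.-integrable D F.
  apply/integrableP; split => //; under eq_integral => x Dx.
    rewrite gee0_abs ?F0//; last exact: set_mem.
    over.
  exact: le_lt_trans Goo.
have FB0 : (\int[mu]_(x in D) `|F x - G x| = 0)%E.
  have -> : (\int[mu]_(x in D) `|F x - G x| = \int[mu]_(x in D) (F x - G x))%E.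
    apply: ae_eq_integral => //.
    - apply: measurableT_comp => //; exact: emeasurable_funB.
    - exact: emeasurable_funB.
    - have := integrable_ae mD iG.
      apply: filterS2 GF => x GF Gfin Dx; rewrite gee0_abs// sube_ge0 ?GF//.
      by rewrite Gfin// orbT.
  rewrite integralB//; apply/eqP; rewrite eq_le sube_ge0; last first.
    by rewrite ge0_fin_numE ?Goo ?orbT// integral_ge0.
  rewrite sube_le0 FG /=; exact: ae_ge0_le_integral.
have mFB : measurable_fun D (F \- G)%E by exact: emeasurable_funB.
have /= h := (ae_eq_integral_abs mu mD mFB).1 FB0.
have := integrable_ae mD iG; apply: filterS2 h => x h Gfin Dx.
move: (h Dx) (Gfin Dx) => /=; case: (F x) (G x) => [a||] [b||] //= [/eqP].
by rewrite subr_eq0 => /eqP ->.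
Qed.

Lemma clip_eq_psi {R : realType} {l u psi : R -> R} {t : R} :
  0 < l t -> l t <= u t -> clip l u psi t = psi t ->
  (u t)^-1 <= psi t <= (l t)^-1.
Proof.
move=> l0 lu e; have ul : (u t)^-1 <= (l t)^-1.
  by rewrite lef_pV2// posrE// (lt_le_trans l0).
rewrite -e /clip le_max lexx /= ge_max ul /=.
by rewrite ge_min lexx orbT.
Qed.

(** * Strict gain from clipping on one fiber *)

Section clipped.
Context {R : realType} {f : R * R -> R} (f_density : is_density f).
Context {W : R -> R} (W_loss : general_loss W) (W_cont1 : {for 1, continuous W}).

Lemma measurable_loss_scaled (a : R) : 0 < a ->
  measurable_fun (`]0, +oo[%classic : set R) (fun s => W (a * s)).
Proof.
move=> a0; apply: (measurable_comp _ _ (measurable_loss W_loss)) => //.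
  by move=> _ [s /= + <-]; rewrite !in_itv /= !andbT; exact: mulr_gt0.
Qed.

Lemma clip_nearer {l u psi : R -> R} {lam t m : R} : 0 < lam ->
  suppD f lam t -> is_the_median f lam t m -> 0 < l t -> l t <= m <= u t ->
  0 < psi t -> clip l u psi t != psi t ->
  ((fine (pdfD f lam t) / 2)%:E <
   \int[lebesgue_measure]_(s in `]0%R, +oo[ `&`
       [set s | (W (clip l u psi t * s) < W (psi t * s))%R])
     (ratio_scale_pdf f lam t s)%:E)%E.
Proof.
move=> lam0 t_supp m_med l0 /andP[lm mu] psi0 neq.
have u0 : 0 < u t by rewrite (lt_le_trans l0)// (le_trans lm).
have ul : (u t)^-1 <= (l t)^-1 by rewrite lef_pV2// (le_trans lm).
have a0 : 0 < clip l u psi t by rewrite /clip lt_max invr_gt0 u0.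
have mE : measurable (`]0, +oo[ `&` [set s : R | W (clip l u psi t * s) < W (psi t * s)]).
  by apply: measurable_lt_set => //; exact: measurable_loss_scaled.
have [pu|up] := ltP (psi t) (u t)^-1.
  have aE : clip l u psi t = (u t)^-1.
    by rewrite /clip max_l// ge_min ltW.
  have [||m' um' better] :=
    loss_lt_of_larger_factor W_loss W_cont1 (clip l u psi t) (psi t) => //.
    by rewrite aE.
  rewrite aE invrK in um'.
  apply: lt_le_trans (mass_gt_median f_density lam0 t_supp m_med m' (le_lt_trans mu um')) _.
  apply: (le_mass f_density lam0 _ _ _ mE) => [|s|s []]//.
  rewrite /= !in_itv /= andbT => /andP[s0 sm]; split => //; exact: better.
have [pl|lp] := leP (psi t) (l t)^-1.
  by move: neq; rewrite /clip min_l// max_r// eqxx.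
have aE : clip l u psi t = (l t)^-1 by rewrite /clip min_r ?ltW// max_r.
have [||m' /andP[m'0 ml'] better] :=
  loss_lt_of_smaller_factor W_loss W_cont1 (clip l u psi t) (psi t) => //.
  by rewrite aE.
rewrite aE invrK in ml'.
apply: lt_le_trans (mass_lt_median f_density lam0 t_supp m_med m' _) _.
  by rewrite m'0 (lt_le_trans ml').
apply: (le_mass f_density lam0 _ _ _ mE) => [|s|s []]//.
rewrite /= !in_itv /= !andbT => sm; split; first exact: lt_trans sm.
exact: better.
Qed.

End clipped.

Section equivariant_loss.
Context {R : realType} {W : R -> R} (W_loss : general_loss W).
Variables (th : R * R) (th2_gt0 : 0 < th.2).

(** Equivariance makes the scale th_2 cancel: on the fiber D = t the estimator is a constant factor,
    and the comparison is one-dimensional in s = Z_2. *)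
Lemma loss2_equivariant_fiber (psi : R -> R) (t s : R) : 0 < t -> 0 < s ->
  loss2 W th (equivariant psi (th.2 * s / t, th.2 * s)) = W (psi t * s).
Proof.
move=> t0 s0; rewrite /loss2 /equivariant /=.
have -> : th.2 * s / (th.2 * s / t) = t by field; rewrite !lt0r_neq0.
by congr W; field; rewrite lt0r_neq0.
Qed.

Lemma measurable_quadrant : measurable (@quadrant R).
Proof.
have -> : @quadrant R = `]0, +oo[ `*` `]0, +oo[.
  by apply/seteqP; split => z /=; rewrite !in_itv /= !andbT.
exact: measurableX.
Qed.

Lemma measurable_fun_ratio (g : R -> R) : measurable_fun [set t : R | 0 < t] g ->
  measurable_fun (@quadrant R) (fun x => g (x.2 / x.1)).
Proof.
move=> mg; apply: (measurable_comp _ _ mg).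
- rewrite -[X in measurable X](_ : `]0, +oo[%classic = _) //.
  by apply/seteqP; split => z /=; rewrite in_itv /= andbT.
- by move=> _ [x [x1 x2] <-] /=; rewrite divr_gt0.
- apply: measurable_funTS; apply: measurable_funM => //.
  exact: (measurableT_comp measurable_invr).
Qed.

Lemma measurable_loss2_equivariant (psi : R -> R) :
  measurable_fun [set t : R | 0 < t] psi -> (forall t, 0 < t -> 0 < psi t) ->
  measurable_fun (@quadrant R) (fun x => loss2 W th (equivariant psi x)).
Proof.
move=> mpsi psi0; apply: (measurable_comp _ _ (measurable_loss W_loss)) => //.
  move=> _ [x [x1 x2] <-] /=; rewrite in_itv /= andbT.
  by rewrite divr_gt0// mulr_gt0// psi0// divr_gt0.
apply: measurable_funM => //; apply: measurable_funM; first exact: measurable_fun_ratio.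
exact: measurable_funTS.
Qed.

End equivariant_loss.

(** * The GPN comparison at a fixed parameter *)

Section fixed_theta.
Context {R : realType} {d : measure_display} {T : measurableType d}.
Context {f : R * R -> R} {P : R * R -> probability T R} {X : T -> R * R}.
Context {W psi l u : R -> R} {m : R -> R -> R}.
Hypotheses (f_density : is_density f) (X_pdf : has_joint_pdf P X f).
Hypothesis X_support : forall th, Theta0 th -> P th (X @^-1` quadrant) = 1%E.
Hypotheses (W_loss : general_loss W) (W_cont1 : {for 1, continuous W}).
Hypothesis mpsi : measurable_fun [set t : R | 0 < t] psi.
Hypothesis ml : measurable_fun [set t : R | 0 < t] l.
Hypothesis mu : measurable_fun [set t : R | 0 < t] u.
Hypothesis psi_gt0 : forall t, 0 < t -> 0 < psi t.
Hypothesis m_median : forall lam t, 1 <= lam -> suppD f lam t ->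
  is_the_median f lam t (m lam t).
Hypothesis l_gt0 : forall t, 0 < t -> 0 < l t.
Hypothesis l_m_u : forall lam t, 1 <= lam -> suppD f lam t ->
  l t <= m lam t <= u t.
Context {th : R * R} (th_in : Theta0 th).

Local Notation D := (`]0, +oo[%classic : set (measurableTypeR R)).
Local Notation lam := (th.2 / th.1).
Local Notation fiber E t := (`]0, +oo[ `&` [set s | E (th.2 * s / t, th.2 * s)]).
Local Notation mass E t := (\int[lebesgue_measure]_(s in fiber E t)
  (ratio_scale_pdf f lam t s)%:E)%E.
Local Notation loss_clip x := (loss2 W th (equivariant (clip l u psi) x)).
Local Notation loss_psi x := (loss2 W th (equivariant psi x)).

Let E1 : set (R * R) := [set x | loss_clip x < loss_psi x].
Let E2 : set (R * R) := [set x | loss_clip x = loss_psi x].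
Let E3 : set (R * R) :=
  [set x | (u (x.2 / x.1))^-1 <= psi (x.2 / x.1) <= (l (x.2 / x.1))^-1].

Let th1_gt0 : 0 < th.1. Proof. by case: th_in. Qed.
Let th2_gt0 : 0 < th.2. Proof. by case: th_in => h; exact: lt_le_trans. Qed.
Let lam_ge1 : 1 <= lam.
Proof. by case: th_in => h1 h2; rewrite ler_pdivlMr// mul1r. Qed.
Let lam_gt0 : 0 < lam. Proof. exact: lt_le_trans lam_ge1. Qed.

Let clip_gt0 t : 0 < t -> 0 < clip l u psi t.
Proof.
by move=> t0; rewrite /clip lt_max lt_min psi_gt0//= [X in _ || X]invr_gt0 l_gt0// orbT.
Qed.

Let mclip : measurable_fun [set t : R | 0 < t] (clip l u psi).
Proof.
apply: measurable_maxr; first exact: (measurableT_comp measurable_invr).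
apply: measurable_minr => //; exact: (measurableT_comp measurable_invr).
Qed.

Let mloss_clip := measurable_loss2_equivariant W_loss th th2_gt0 _ mclip clip_gt0.
Let mloss_psi := measurable_loss2_equivariant W_loss th th2_gt0 _ mpsi psi_gt0.

Let mE1 : measurable (quadrant `&` E1).
Proof. exact: measurable_lt_set measurable_quadrant mloss_clip mloss_psi. Qed.

Let mE2 : measurable (quadrant `&` E2).
Proof.
rewrite (_ : E2 = [set x | ((loss_clip x)%:E = (loss_psi x)%:E)%E]); last first.
  by apply/seteqP; split => x /= => [->//|[]].
by apply: measurable_eqe; [exact: measurable_quadrant | exact/measurable_EFinP..].
Qed.

Let mE3 : measurable (quadrant `&` E3).
Proof.
have mr (g : R -> R) : measurable_fun [set t : R | 0 < t] g ->
    measurable_fun (@quadrant R) (fun x => (g (x.2 / x.1))%:E).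
  by move=> mg; apply/measurable_EFinP; exact: measurable_fun_ratio.
have mV (g : R -> R) : measurable_fun [set t : R | 0 < t] g ->
    measurable_fun [set t : R | 0 < t] (fun t => (g t)^-1).
  exact: (measurableT_comp measurable_invr).
rewrite (_ : quadrant `&` E3 =
  (quadrant `&` [set x | ((u (x.2 / x.1))^-1%:E <= (psi (x.2 / x.1))%:E)%E]) `&`
  (quadrant `&` [set x | ((psi (x.2 / x.1))%:E <= (l (x.2 / x.1))^-1%:E)%E])).
  apply: measurableI; apply: measurable_lee; try exact: measurable_quadrant.
  - exact: (mr (fun t => (u t)^-1) (mV _ mu)).
  - exact: mr.
  - exact: mr.
  - exact: (mr (fun t => (l t)^-1) (mV _ ml)).
apply/seteqP; split => x /=; rewrite !lee_fin; first by move=> [Q /andP[]].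
by move=> [[Q h] [_ h']]; split => //; apply/andP.
Qed.

Let mT : measurable (quadrant `&` [set: R * R]).
Proof. by rewrite setIT; exact: measurable_quadrant. Qed.

Let mass0 (E : set (R * R)) t : (0 <= mass E t)%E.
Proof.
apply: integral_ge0 => s [/=]; rewrite in_itv /= andbT lee_fin => s0 _.
exact: ratio_scale_pdf_ge0.
Qed.

Let mmass E mE := @measurable_fiber_mass R f f_density th th_in E mE.
Let PrE E mE := @Pr_disintegration R d T f P X f_density X_pdf th th_in E mE.

Let F0 t := mass [set: R * R] t.
(** The contribution of D = t to the GPN, weighted by the density [F0 t] of [D]; the target is half
    of [F0 t]. *)
Let F t := (mass E1 t + (2^-1)%:E * mass E2 t)%E.

Let mF : measurable_fun D F.
Proof. by apply: emeasurable_funD; [exact: mmass | apply: measurable_funeM; exact: mmass]. Qed.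

Let F_ge0 t : (0 <= F t)%E.
Proof. by rewrite adde_ge0// mule_ge0// lee_fin. Qed.

(** The support assumption enters here: the quadrant carries the whole mass of [X]. *)
Let int_F0 : (\int[lebesgue_measure]_(t in D) F0 t = 1)%E.
Proof. by rewrite -PrE// /Pr setIT X_support. Qed.

Let GPN_F : GPN P X W (equivariant (clip l u psi)) (equivariant psi) th =
  (\int[lebesgue_measure]_(t in D) F t)%E.
Proof.
have mZ : measurable_fun D (fun t => (2^-1)%:E * mass E2 t)%E.
  by apply: measurable_funeM; exact: mmass.
have half0 : (0 <= (2^-1 : R)%:E)%E by rewrite lee_fin.
rewrite /GPN !PrE//.
rewrite -(ge0_integralZl lebesgue_measure _ (mmass _ mE2)
  (fun t _ => mass0 E2 t) half0)//.
have Z0 t : D t -> (0 <= (2^-1)%:E * mass E2 t)%E by move=> _; exact: mule_ge0.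
by rewrite -(ge0_integralD lebesgue_measure _ (fun t _ => mass0 E1 t) (mmass _ mE1) Z0 mZ).
Qed.

Let F0E t : F0 t = pdfD f lam t.
Proof. by rewrite /F0 (_ : fiber _ t = `]0, +oo[%classic)// setIT. Qed.

Let fiber_ext (A B : set (R * R)) t :
  (forall s, 0 < s -> A (th.2 * s / t, th.2 * s) <-> B (th.2 * s / t, th.2 * s)) ->
  fiber A t = fiber B t.
Proof.
move=> AB; apply/seteqP.
by split=> s [s0 h]; split=> //; apply/AB => //; move: s0; rewrite /= in_itv /= andbT.
Qed.

(** The second part is the equality case: the fiber is then either massless or has psi(t) within its
    bounds. *)
Let F_half t : 0 < t -> F0 t \is a fin_num -> ((2^-1)%:E * F0 t <= F t)%E /\
  (F t = (2^-1)%:E * F0 t -> mass E3 t = F0 t)%E.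
Proof.
move=> t0 F0fin.
have fiber_ratio s : 0 < s -> th.2 * s / (th.2 * s / t) = t.
  by move=> s0; field; rewrite !lt0r_neq0.
have mass_E3 : (u t)^-1 <= psi t <= (l t)^-1 -> mass E3 t = F0 t.
  move=> b; congr (\int[_]_(s in _) _)%E; apply: fiber_ext => s s0; split => // _.
  by rewrite /E3 /= fiber_ratio.
(* A fiber without mass lies outside [suppD], so it has no median to compare with and psi(t) may be
   out of bounds; then its part in [E3] is empty and both masses are 0. *)
have [F00|F0n] := eqVneq (F0 t) 0%E.
  split; first by rewrite F00 mule0.
  move=> _; have [/mass_E3 -> //|out] := boolP ((u t)^-1 <= psi t <= (l t)^-1).
  rewrite F00 (_ : fiber E3 t = set0) ?integral_set0//.
  apply/seteqP; split=> s //= [+ h]; rewrite in_itv /= andbT => s0.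
  by move/negP: out; apply; move: h; rewrite /E3 /= fiber_ratio.
have t_supp : suppD f lam t.
  split => //; rewrite -F0E lt_neqAle eq_sym F0n mass0/=.
  by rewrite -ge0_fin_numE// mass0.
have halfE : ((2^-1)%:E * F0 t = (fine (pdfD f lam t) / 2)%:E)%E.
  by rewrite -(fineK F0fin) -EFinM F0E mulrC.
have lmu := l_m_u _ _ lam_ge1 t_supp.
have [e|ne] := eqVneq (clip l u psi t) (psi t).
  have E2T : mass E2 t = F0 t.
    congr (\int[_]_(s in _) _)%E; apply: fiber_ext => s s0; split => // _.
    by rewrite /E2 /= !loss2_equivariant_fiber// e.
  split; first by rewrite /F E2T leeDr.
  move=> _; apply: mass_E3.
  apply: clip_eq_psi => //; first exact: l_gt0.
  by case/andP: lmu; exact: le_trans.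
have better : ((2^-1)%:E * F0 t < F t)%E.
  apply: (@lt_le_trans _ _ (mass E1 t)); last by rewrite /F leeDl// mule_ge0// lee_fin.
  rewrite halfE.
  have := clip_nearer f_density W_loss W_cont1 lam_gt0 t_supp
    (m_median _ _ lam_ge1 t_supp) (l_gt0 _ t0) lmu (psi_gt0 _ t0) ne.
  congr (_ < \int[_]_(s in _) _)%E; apply/seteqP.
  by split=> s [s0 h]; split=> //; move: s0 h; rewrite /= in_itv /= andbT => s0;
    rewrite /E1 /= !loss2_equivariant_fiber.
by split; [exact: ltW | move=> e; move: better; rewrite e ltxx].
Qed.

Let mF0 : measurable_fun D F0. Proof. exact: mmass. Qed.

(** A function with integral 1 is finite almost everywhere; this disposes of the t that [suppD]
    leaves out as infinite. *)
Let F0_fin : {ae lebesgue_measure, forall t, D t -> F0 t \is a fin_num}.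
Proof.
apply: integrable_ae => //; apply/integrableP; split => //.
under eq_integral do rewrite gee0_abs ?mass0//.
by rewrite int_F0 ltry.
Qed.

Let half_le_F :
  {ae lebesgue_measure, forall t, D t -> ((2^-1)%:E * F0 t <= F t)%E}.
Proof.
apply: filterS F0_fin => t fin t0; apply: (F_half t _ (fin t0)).1.
by move: t0; rewrite /= in_itv /= andbT.
Qed.

Let half_F0_ge0 t : D t -> (0 <= (2^-1)%:E * F0 t)%E.
Proof. by move=> _; apply: mule_ge0; [rewrite lee_fin | exact: mass0]. Qed.

Let mhalf_F0 : measurable_fun D (fun t => (2^-1)%:E * F0 t)%E.
Proof. exact: measurable_funeM. Qed.

Let int_half_F0 :
  (\int[lebesgue_measure]_(t in D) ((2^-1)%:E * F0 t) = (2^-1)%:E)%E.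
Proof.
rewrite (ge0_integralZl lebesgue_measure _ mF0 (fun t _ => mass0 setT t)) ?lee_fin//.
by rewrite int_F0 mule1.
Qed.

Lemma half_le_GPN_clip : ((2^-1)%:E <=
  GPN P X W (equivariant (clip l u psi)) (equivariant psi) th)%E.
Proof.
by rewrite GPN_F -int_half_F0; apply: ae_ge0_le_integral.
Qed.

(** By contraposition: if the GPN is at most 1/2, the fiberwise inequality is an equality for almost
    every t, so [E3] carries the full mass of almost every fiber and has probability 1. *)
Lemma half_lt_GPN_clip :
  (Pr P X th [set x | ((u (x.2 / x.1))^-1 <= psi (x.2 / x.1)
                        <= (l (x.2 / x.1))^-1)%R] < 1)%E ->
  ((2^-1)%:E <
   GPN P X W (equivariant (clip l u psi)) (equivariant psi) th)%E.
Proof.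
apply: contraTT; rewrite -!leNgt GPN_F -int_half_F0 => le_half.
have eq_half : ae_eq lebesgue_measure D F (fun t => (2^-1)%:E * F0 t)%E.
  apply: ae_eq_of_ge0_integral_le => //; by rewrite int_half_F0 ltry.
rewrite (PrE E3 mE3) -int_F0.
suff -> : (\int[lebesgue_measure]_(t in D) F0 t =
  \int[lebesgue_measure]_(t in D) mass E3 t)%E by [].
apply: ge0_ae_eq_integral => //; first exact: mmass.
  by move=> t _; exact: mass0.
apply: filterS2 F0_fin eq_half => t fin eqt t0; apply/esym.
apply: (F_half t _ (fin t0)).2 (eqt t0).
by move: t0; rewrite /= in_itv /= andbT.
Qed.

End fixed_theta.

Theorem theorem4p2p1 (R : realType) (d : measure_display)
    (T : measurableType d) (f : R * R -> R)
    (P : R * R -> probability T R) (X : T -> R * R)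
    (W psi l u : R -> R) (m : R -> R -> R)
    (f_density : is_density f)
    (X_measurable : measurable_fun setT X)
    (X_pdf : has_joint_pdf P X f)
    (X_support : forall th, Theta0 th -> P th (X @^-1` quadrant) = 1%E)
    (W_loss : general_loss W)
    (W_continuous1 : {for 1, continuous W})
    (psi_measurable : measurable_fun [set t : R | 0 < t] psi)
    (l_measurable : measurable_fun [set t : R | 0 < t] l)
    (u_measurable : measurable_fun [set t : R | 0 < t] u)
    (psi_gt0 : forall t, 0 < t -> 0 < psi t)
    (m_median : forall lam t, 1 <= lam -> suppD f lam t ->
       is_the_median f lam t (m lam t))
    (l_gt0 : forall t, 0 < t -> 0 < l t)
    (l_m_u : forall lam t, 1 <= lam -> suppD f lam t ->
       l t <= m lam t <= u t)
    (psi_outside : forall th, Theta0 th ->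
       (Pr P X th [set x | ((u (x.2 / x.1))^-1 <= psi (x.2 / x.1)
                              <= (l (x.2 / x.1))^-1)%R] < 1)%E) :
  nearer P X W (equivariant (clip l u psi)) (equivariant psi).
Proof.
split=> [th th_in|]; first exact: (half_le_GPN_clip (f := f) (m := m)).
(* Strictness holds at every parameter, so any point of [Theta0] can serve as witness. *)
have th_in : @Theta0 R (1, 1) by rewrite /Theta0 /= ltr01 lexx.
exists (1, 1) => //; apply: (half_lt_GPN_clip (f := f) (m := m)) => //.
exact: psi_outside.
Qed.
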